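(* Let $G$ be a finitely generated group and let $F\twoheadrightarrow G$ be a surjective homomorphism (a presentation), where $F$ is a free group of finite rank. Then the cokernel of the map $$H_2(\widehat F)\oplus H_2(G)\longrightarrow H_2(\widehat G)$$ induced by the homomorphism $\widehat F\to\widehat G$ and the canonical homomorphism $G\to\widehat G$ is a cotorsion group.
   Context: For a group $G$, the lower central series is $\gamma_1(G)=G$, $\gamma_{i+1}(G)=[\gamma_i(G),G]$ for $i\ge 1$, and the pronilpotent completion of $G$ is $\widehat G=\varprojlim_i G/\gamma_i(G)$, regarded as an abstract group. $H_2(-)=H_2(-,\mathbb Z)$ is ordinary integral group homology. An abelian group $A$ is called cotorsion if $\mathrm{Ext}^1_{\mathbb Z}(\mathbb Q,A)=0$. *)

(* Defs.v *)
From HB Require Import structures.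
From mathcomp Require Import all_boot all_order all_algebra.
From mathcomp Require Import boolp functions ring.
From mathcomp.multinomials Require Import freeg.

Set Implicit Arguments.
Unset Strict Implicit.
Unset Printing Implicit Defensive.

Import GRing.Theory.
Local Open Scope quotient_scope.

Section GroupMorphisms.
Local Open Scope group_scope.
Variables (G H : groupType) (f : {multiplicative G -> H}).

Lemma gmorph1 : f 1 = 1.
Proof. by apply: (mulgI (f 1)); rewrite -gmulfM !mulg1. Qed.

Lemma gmorphV x : f x^-1 = (f x)^-1.
Proof. by apply: (mulgI (f x)); rewrite -gmulfM !mulgV gmorph1. Qed.

Lemma gmorphJ x y : f (x ^ y) = f x ^ f y.
Proof. by rewrite /conjg !gmulfM gmorphV. Qed.

Lemma gmorphR x y : f [~ x, y] = [~ f x, f y].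
Proof. by rewrite /commg gmulfM gmorphV gmorphJ. Qed.

End GroupMorphisms.

HB.mixin Record isConjClosed (G : groupType) (S : {pred G}) := {
  gpredJn : forall x y, x \in S -> (x ^ y)%g \in S
}.

#[short(type="normalClosed")]
HB.structure Definition NormalClosed G :=
  {S of GroupClosed G S & isConjClosed G S}.

Module QuotientGroup.
Section QuotientGroup.
Local Open Scope group_scope.
Variables (G : groupType) (N : normalClosed G).

Definition equiv (x y : G) := x / y \in N.

Lemma equivE x y : equiv x y = (x / y \in N). Proof. by []. Qed.

Lemma equiv_is_equiv : equiv_class_of equiv.
Proof.
split=> [x|x y|y x z]; rewrite !equivE ?divgg ?gpred1 //.
  by rewrite -[in LHS]invgF gpredV.
by move=> xy yz; rewrite -(divgKA y); exact: gpredM.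
Qed.

Canonical equiv_equiv := EquivRelPack equiv_is_equiv.
Canonical equiv_encModRel := defaultEncModRel equiv.

Definition quot := {eq_quot equiv}.

#[export]
HB.instance Definition _ : EqQuotient G equiv quot := EqQuotient.on quot.
#[export]
HB.instance Definition _ := Choice.on quot.

Lemma quotE x y : (x / y \in N) = (x == y %[mod quot]).
Proof. by rewrite piE equivE. Qed.

Definition one : quot := lift_cst quot 1.
Definition mul := lift_op2 quot *%g.
Definition inv := lift_op1 quot (fun x => x^-1).

Canonical pi_one_morph := PiConst one.

Lemma pi_inv : {morph \pi : x / x^-1 >-> inv x}.
Proof.
move=> x; unlock inv; apply/eqP; rewrite piE equivE invgK.
set r := repr _; have : x / r \in N by rewrite quotE reprK.
move/(gpredJn _ x); rewrite conjgE mulgA mulKg => /gpredVr.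
by rewrite invgM invgK.
Qed.
Canonical pi_inv_morph := PiMorph1 pi_inv.

Lemma pi_mul : {morph \pi : x y / x * y >-> mul x y}.
Proof.
move=> x y; unlock mul; apply/eqP; rewrite piE equivE.
set a := repr _; set b := repr _.
have xa : x / a \in N by rewrite quotE reprK.
have yb : y / b \in N by rewrite quotE reprK.
have -> : x * y / (a * b) = (y / b) ^ x^-1 * (x / a).
  by rewrite conjgE invgK invgM !mulgA mulgVK.
by rewrite gpredM // gpredJn.
Qed.
Canonical pi_mul_morph := PiMorph2 pi_mul.

Lemma mulqA : associative mul.
Proof. by move=> x y z; rewrite -[x]reprK -[y]reprK -[z]reprK !piE mulgA. Qed.

Lemma mul1q : left_id one mul.
Proof. by move=> x; rewrite -[x]reprK !piE mul1g. Qed.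

Lemma mulq1 : right_id one mul.
Proof. by move=> x; rewrite -[x]reprK !piE mulg1. Qed.

Lemma mulVq : left_inverse one inv mul.
Proof. by move=> x; rewrite -[x]reprK !piE mulVg. Qed.

Lemma mulqV : right_inverse one inv mul.
Proof. by move=> x; rewrite -[x]reprK !piE mulgV. Qed.

#[export]
HB.instance Definition _ := isGroup.Build quot mulqA mul1q mulq1 mulVq mulqV.

Lemma pi_multiplicative : {morph \pi_quot : x y / x * y}.
Proof. by move=> x y; rewrite pi_mul. Qed.

End QuotientGroup.

Module Exports. HB.reexport. End Exports.
End QuotientGroup.
Export QuotientGroup.Exports.

Notation quotg := QuotientGroup.quot.

Section Projection.
Local Open Scope group_scope.
Variables (G : groupType) (N : normalClosed G).

Definition projg (x : G) : quotg N := \pi x.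

HB.instance Definition _ :=
  isMultiplicative.Build G (quotg N) projg
    (@QuotientGroup.pi_multiplicative G N).

Lemma projg_eq x y : (projg x = projg y) <-> (x / y \in N).
Proof. by rewrite QuotientGroup.quotE; split=> [/eqP|/eqP]. Qed.

Lemma projg_surj (a : quotg N) : exists x, projg x = a.
Proof. by exists (repr a); exact: reprK. Qed.

End Projection.

Section QuotientMap.
Local Open Scope group_scope.
Variables (G H : groupType) (N : normalClosed G) (M : normalClosed H).
Variables (f : {multiplicative G -> H}) (fNM : forall x, x \in N -> f x \in M).

(* The vacuous let makes fNM an argument of quotg_map, so that the morphism
   instance below can be inferred. *)
Definition quotg_map (a : quotg N) : quotg M :=
  let _ := fNM in projg M (f (repr a)).

Lemma quotg_mapE x : quotg_map (projg N x) = projg M (f x).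
Proof.
apply/projg_eq; rewrite -gmorphV -gmulfM; apply: fNM.
by rewrite -projg_eq /projg reprK.
Qed.

Lemma quotg_map_multiplicative : {morph quotg_map : a b / a * b}.
Proof.
move=> a b; have [x <-] := projg_surj a; have [y <-] := projg_surj b.
by rewrite -gmulfM !quotg_mapE !gmulfM.
Qed.

HB.instance Definition _ :=
  isMultiplicative.Build (quotg N) (quotg M) quotg_map quotg_map_multiplicative.

End QuotientMap.

Section Generation.
Local Open Scope group_scope.
Variable G : groupType.
Implicit Types S A B : {pred G}.

Definition subgroup_generated S : {pred G} :=
  [pred x | `[< forall H : {pred G},
                  group_closed H -> {subset S <= H} -> x \in H >]].

Lemma generatedP S x :
  reflect (forall H : {pred G}, group_closed H -> {subset S <= H} -> x \in H)
          (x \in subgroup_generated S).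
Proof. exact: asboolP. Qed.

Lemma sub_generated S : {subset S <= subgroup_generated S}.
Proof. by move=> x xS; apply/generatedP => H _; apply. Qed.

Lemma generated_closed S : group_closed (subgroup_generated S).
Proof.
split=> [|x y /generatedP Sx /generatedP Sy]; apply/generatedP => H gH sSH.
  by case: gH.
by case: (gH) => _; apply; [exact: Sx | exact: Sy].
Qed.

HB.instance Definition _ S :=
  isMulClosed.Build G (subgroup_generated S)
    (group_closedM (generated_closed S)).
HB.instance Definition _ S :=
  isMul1Closed.Build G (subgroup_generated S) (generated_closed S).1.
HB.instance Definition _ S :=
  isInvClosed.Build G (subgroup_generated S)
    (group_closedV (generated_closed S)).

Definition commutator_subgroup A B : {pred G} :=
  subgroup_generated
    [pred z | `[< exists x y, [/\ x \in A, y \in B & z = [~ x, y]] >]].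

Definition finitely_generated : Prop :=
  exists s : seq G, forall x, x \in subgroup_generated (mem s).

End Generation.

Definition free_basis (F : groupType) (I : Type) (b : I -> F) : Prop :=
  forall (H : groupType) (h : I -> H),
    (exists f : {multiplicative F -> H}, forall i, f (b i) = h i)
    /\ (forall f g : {multiplicative F -> H},
          (forall i, f (b i) = h i) -> (forall i, g (b i) = h i) -> f =1 g).

Definition free_of_finite_rank (F : groupType) : Prop :=
  exists (n : nat) (b : 'I_n -> F), free_basis b.

Section LowerCentralSeries.
Local Open Scope group_scope.

Variable G : groupType.

(* Indices are shifted: lcs G i is the subgroup gamma_(i+1)(G), so that lcs G 0
   is the whole of G. *)
Fixpoint lcs (i : nat) : {pred G} :=
  if i is j.+1 then commutator_subgroup (lcs j) predT else predT.

Lemma lcs_closed i : group_closed (lcs i).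
Proof. by case: i => [|i] //; exact: generated_closed. Qed.

HB.instance Definition _ i :=
  isMulClosed.Build G (lcs i) (group_closedM (lcs_closed i)).
HB.instance Definition _ i :=
  isMul1Closed.Build G (lcs i) (lcs_closed i).1.
HB.instance Definition _ i :=
  isInvClosed.Build G (lcs i) (group_closedV (lcs_closed i)).

End LowerCentralSeries.

Arguments lcs : clear implicits.

Lemma lcs_morph (G H : groupType) (f : {multiplicative G -> H}) i x :
  x \in lcs G i -> f x \in lcs H i.
Proof.
elim: i x => [//|i IHi] x; set S := [pred u | f u \in lcs H i.+1].
have inS u : (u \in S) = (f u \in lcs H i.+1) by [].
move=> /generatedP/(_ S); apply.
  split=> [|u v]; rewrite !inS; first by rewrite gmorph1 gpred1.
  by rewrite gmulfM gmorphV => fu fv; rewrite gpredM // gpredVr.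
move=> _ /asboolP[u [v [uG _ ->]]]; rewrite inS gmorphR; apply: sub_generated.
by apply/asboolP; exists (f u), (f v); split=> //; exact: IHi.
Qed.

Section Conjugation.
Local Open Scope group_scope.
Variables (G : groupType) (y : G).
Definition conj_by (x : G) := x ^ y.
HB.instance Definition _ :=
  isMultiplicative.Build G G conj_by (fun u v => conjMg u v y).
End Conjugation.

HB.instance Definition _ (G : groupType) i :=
  isConjClosed.Build G (lcs G i) (fun x y => @lcs_morph G G (conj_by y) i x).

Lemma lcsS (G : groupType) i x : x \in lcs G i.+1 -> x \in lcs G i.
Proof.
move=> /generatedP/(_ (lcs G i)); apply; first exact: lcs_closed.
move=> _ /asboolP[u [v [uG _ ->]]].
by rewrite /commg gpredM ?gpredVr ?gpredJn.
Qed.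

Section Completion.
Local Open Scope group_scope.
Variable G : groupType.

Definition nilquot (i : nat) : groupType := quotg (lcs G i).

Definition nilquot_trans (i : nat) : nilquot i.+1 -> nilquot i :=
  quotg_map (f := idfun) (@lcsS G i).

HB.instance Definition _ i := Multiplicative.on (@nilquot_trans i).

Record completion := Completion {
  coord :> forall i, nilquot i;
  coord_compat : forall i, nilquot_trans (coord i.+1) = coord i
}.

Lemma completion_ext (x y : completion) : (forall i, x i = y i) -> x = y.
Proof.
case: x y => [x xP] [y yP] /= eq_xy.
have {}eq_xy : x = y by apply: functional_extensionality_dep.
by subst y; congr Completion; exact: Prop_irrelevance.
Qed.

HB.instance Definition _ := gen_eqMixin completion.
HB.instance Definition _ := gen_choiceMixin completion.

Lemma one_compat i : nilquot_trans (1 : nilquot i.+1) = 1.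
Proof. exact: gmorph1. Qed.

Lemma mul_compat (x y : completion) i :
  nilquot_trans (x i.+1 * y i.+1) = x i * y i.
Proof. by rewrite -(coord_compat x i) -(coord_compat y i); exact: gmulfM. Qed.

Lemma inv_compat (x : completion) i : nilquot_trans (x i.+1)^-1 = (x i)^-1.
Proof. by rewrite -(coord_compat x i); exact: gmorphV. Qed.

Definition completion_one := Completion one_compat.
Definition completion_mul x y := Completion (mul_compat x y).
Definition completion_inv x := Completion (inv_compat x).

Lemma completion_mulA : associative completion_mul.
Proof. by move=> x y z; apply: completion_ext => i /=; rewrite mulgA. Qed.
Lemma completion_1mul : left_id completion_one completion_mul.
Proof. by move=> x; apply: completion_ext => i /=; rewrite mul1g. Qed.
Lemma completion_mul1 : right_id completion_one completion_mul.
Proof. by move=> x; apply: completion_ext => i /=; rewrite mulg1. Qed.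
Lemma completion_Vmul :
  left_inverse completion_one completion_inv completion_mul.
Proof. by move=> x; apply: completion_ext => i /=; rewrite mulVg. Qed.
Lemma completion_mulV :
  right_inverse completion_one completion_inv completion_mul.
Proof. by move=> x; apply: completion_ext => i /=; rewrite mulgV. Qed.

HB.instance Definition _ := isGroup.Build completion completion_mulA
  completion_1mul completion_mul1 completion_Vmul completion_mulV.

Lemma projg_compat (g : G) i :
  nilquot_trans (projg (lcs G i.+1) g) = projg (lcs G i) g.
Proof. by rewrite /nilquot_trans quotg_mapE. Qed.

Definition to_completion (g : G) : completion := Completion (projg_compat g).

Lemma to_completion_mul : {morph to_completion : x y / x * y}.
Proof. by move=> x y; apply: completion_ext => i /=; rewrite gmulfM. Qed.

HB.instance Definition _ :=
  isMultiplicative.Build G completion to_completion to_completion_mul.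

End Completion.

Section CompletionMap.
Local Open Scope group_scope.
Variables (G H : groupType) (f : {multiplicative G -> H}).

Definition nilquot_map i : nilquot G i -> nilquot H i :=
  quotg_map (@lcs_morph G H f i).

HB.instance Definition _ i := Multiplicative.on (@nilquot_map i).

Lemma nilquot_map_compat (x : completion G) i :
  nilquot_trans (nilquot_map (x i.+1)) = nilquot_map (x i).
Proof.
rewrite -(coord_compat x i); have [g <-] := projg_surj (x i.+1).
by rewrite /nilquot_map /nilquot_trans !quotg_mapE.
Qed.

Definition completion_map (x : completion G) : completion H :=
  Completion (nilquot_map_compat x).

Lemma completion_map_mul : {morph completion_map : x y / x * y}.
Proof. by move=> x y; apply: completion_ext => i /=; rewrite -gmulfM. Qed.

HB.instance Definition _ :=
  isMultiplicative.Build _ _ completion_map completion_map_mul.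

End CompletionMap.

Local Open Scope ring_scope.

Section KernelCokernel.
Variables (A B : zmodType) (f : {additive A -> B}).

Definition ker_pred : {pred A} := [pred x | f x == 0].
Definition im_pred : {pred B} := [pred y | `[< exists x, f x = y >]].

Lemma ker_closed : zmod_closed ker_pred.
Proof.
split=> [|x y]; rewrite !inE ?raddf0 // => /eqP fx /eqP fy.
by rewrite raddfB fx fy subr0.
Qed.

Lemma im_closed : zmod_closed im_pred.
Proof.
split; first by apply/asboolP; exists 0; rewrite raddf0.
move=> _ _ /asboolP[x <-] /asboolP[y <-].
by apply/asboolP; exists (x - y); rewrite raddfB.
Qed.

HB.instance Definition _ := GRing.isZmodClosed.Build A ker_pred ker_closed.
HB.instance Definition _ := GRing.isZmodClosed.Build B im_pred im_closed.

Record ker := Ker { ker_val : A; _ : ker_val \in ker_pred }.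

HB.instance Definition _ := [isSub for ker_val].
HB.instance Definition _ := [Choice of ker by <:].
HB.instance Definition _ := [SubChoice_isSubZmodule of ker by <:].

Lemma ker_valK z : f (ker_val z) = 0.
Proof. by case: z => z /= /eqP. Qed.

Lemma ker_val_additive : zmod_morphism ker_val.
Proof. exact: (raddfB (val : ker -> A)). Qed.

HB.instance Definition _ :=
  GRing.isZmodMorphism.Build ker A ker_val ker_val_additive.

Definition coker : zmodType := {ideal_quot im_pred}.

Definition to_coker (y : B) : coker := \pi y.

Lemma to_coker_additive : zmod_morphism to_coker.
Proof. by move=> x y; rewrite /to_coker [LHS]raddfB. Qed.

HB.instance Definition _ :=
  GRing.isZmodMorphism.Build B coker to_coker to_coker_additive.

Lemma to_coker_surj (c : coker) : exists y, to_coker y = c.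
Proof. by exists (repr c); exact: reprK. Qed.

Lemma to_coker_eq0 y : to_coker y = 0 <-> exists x, f x = y.
Proof.
rewrite -(raddf0 to_coker) (rwP eqP) -Quotient.idealrBE subr0.
by split=> [/asboolP|/asboolP].
Qed.

End KernelCokernel.

Section CokernelMap.
Variables (A B A' B' : zmodType).
Variables (f : {additive A -> B}) (f' : {additive A' -> B'}).
Variables (a : A -> A') (b : {additive B -> B'}).
Hypothesis comm_sq : forall x, b (f x) = f' (a x).

(* As for quotg_map, the vacuous let records comm_sq as an argument. *)
Definition coker_map (c : coker f) : coker f' :=
  let _ := comm_sq in to_coker f' (b (repr c)).

Lemma coker_mapE y : coker_map (to_coker f y) = to_coker f' (b y).
Proof.
have /to_coker_eq0[x fx] : to_coker f (repr (to_coker f y) - y) = 0.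
  by rewrite raddfB; apply/eqP; rewrite subr_eq0; apply/eqP; exact: reprK.
apply/eqP; rewrite -subr_eq0 -!raddfB -fx comm_sq; apply/eqP.
by apply/to_coker_eq0; exists (a x).
Qed.

Lemma coker_map_additive : zmod_morphism coker_map.
Proof.
move=> c e; have [x <-] := to_coker_surj c; have [y <-] := to_coker_surj e.
by rewrite -raddfB !coker_mapE !raddfB.
Qed.

HB.instance Definition _ :=
  GRing.isZmodMorphism.Build (coker f) (coker f') coker_map coker_map_additive.

End CokernelMap.

Section LinearExtension.
Variables (K : choiceType) (M : zmodType) (f : K -> M).

(* fglift needs an int-module as target, and zmodule M is M with its canonical
   one. *)
Definition zlift : {freeg K / int} -> M :=
  fglift (f : K -> zmodule M).

Lemma zlift_additive : zmod_morphism zlift.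
Proof. exact: (lift_is_additive (f : K -> zmodule M)). Qed.

HB.instance Definition _ :=
  GRing.isZmodMorphism.Build {freeg K / int} M zlift zlift_additive.

Lemma zliftU k : zlift << k >> = f k.
Proof. by rewrite /zlift liftU scale1r. Qed.

End LinearExtension.

Lemma freeg_additive_ext (K : choiceType) (M : zmodType)
    (f g : {additive {freeg K / int} -> M}) :
  (forall k, f << k >> = g << k >>) -> f =1 g.
Proof.
move=> fg D; rewrite -[D]freeg_sumE !raddf_sum; apply: eq_bigr => k _.
by rewrite -[coeff k D]intz -freegU_mulz !raddfMz fg.
Qed.

Section Hom.
Variables U V : zmodType.

Definition additive_pred : {pred U -> V} := [pred f | `[< zmod_morphism f >]].

Lemma additive_pred_closed : zmod_closed additive_pred.
Proof.
split=> [|f g /asboolP fM /asboolP gM].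
  by apply/asboolP => x y; rewrite subr0.
apply/asboolP => x y.
change (f (x - y) - g (x - y) = f x - g x - (f y - g y)).
by rewrite fM gM !opprB addrACA [RHS]addrACA [- f y + _]addrC.
Qed.

HB.instance Definition _ :=
  GRing.isZmodClosed.Build (U -> V) additive_pred additive_pred_closed.

Record homZ := HomZ { homZ_val :> U -> V; _ : homZ_val \in additive_pred }.

HB.instance Definition _ := [isSub for homZ_val].
HB.instance Definition _ := [Choice of homZ by <:].
HB.instance Definition _ := [SubChoice_isSubZmodule of homZ by <:].

Lemma homZ_additive (f : homZ) : zmod_morphism f.
Proof. exact/asboolP/(valP f). Qed.

HB.instance Definition _ (f : homZ) :=
  GRing.isZmodMorphism.Build U V (homZ_val f) (homZ_additive f).

Lemma mem_additive_pred (f : {additive U -> V}) :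
  (f : U -> V) \in additive_pred.
Proof. by apply/asboolP; exact: raddfB. Qed.

Definition to_homZ (f : {additive U -> V}) : homZ := HomZ (mem_additive_pred f).

End Hom.

Section Precomposition.
Variables (U U' V : zmodType) (i : {additive U -> U'}).

Definition precomp (f : homZ U' V) : homZ U V := to_homZ (f \o i).

Lemma precomp_additive : zmod_morphism precomp.
Proof. by move=> f g; apply: val_inj. Qed.

HB.instance Definition _ :=
  GRing.isZmodMorphism.Build (homZ U' V) (homZ U V) precomp precomp_additive.

End Precomposition.

Section Ext.
Variables B A : zmodType.

(* Ext^1(B, A) is computed from the free resolution 0 -> K -> Z[B] -> B -> 0,
   where Z[B] is the free abelian group on the underlying set of B; subgroups of
   free abelian groups being free, K is free and the sequence
   Hom(Z[B], A) -> Hom(K, A) -> Ext^1(B, A) -> 0 is exact. *)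
Definition free_cover : {additive {freeg B / int} -> B} := @zlift B B id.

Definition relations : zmodType := ker free_cover.

Definition relations_incl : {additive relations -> {freeg B / int}} :=
  @ker_val _ _ free_cover.

Definition Ext1 : zmodType := coker (@precomp _ _ A relations_incl).

End Ext.

Definition cotorsion (A : zmodType) : Prop := forall x : Ext1 rat A, x = 0.

Section Homology.
Variables (C C' C'' : zmodType).
Variables (d : {additive C -> C'}) (d' : {additive C' -> C''}).
Hypothesis dd0 : forall x, d' (d x) = 0.

Lemma boundary_cycle x : d x \in ker_pred d'.
Proof. by rewrite inE dd0. Qed.

Definition to_cycles (x : C) : ker d' := Ker (boundary_cycle x).

Lemma to_cycles_additive : zmod_morphism to_cycles.
Proof. by move=> x y; apply: val_inj; rewrite /= !raddfB. Qed.

HB.instance Definition _ :=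
  GRing.isZmodMorphism.Build C (ker d') to_cycles to_cycles_additive.

Definition homology : zmodType := coker to_cycles.

End Homology.

Section HomologyMap.
Variables (C C' C'' E E' E'' : zmodType).
Variables (d : {additive C -> C'}) (d' : {additive C' -> C''}).
Variables (e : {additive E -> E'}) (e' : {additive E' -> E''}).
Hypotheses (dd0 : forall x, d' (d x) = 0) (ee0 : forall x, e' (e x) = 0).
Variables (phi : {additive C -> E}) (phi' : {additive C' -> E'}).
Variables (phi'' : {additive C'' -> E''}).
Hypothesis comm : forall x, phi' (d x) = e (phi x).
Hypothesis comm' : forall x, phi'' (d' x) = e' (phi' x).

Lemma cycle_map_subproof (z : ker d') : phi' (ker_val z) \in ker_pred e'.
Proof. by rewrite inE -comm' ker_valK raddf0. Qed.

Definition cycle_map (z : ker d') : ker e' := Ker (cycle_map_subproof z).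

Lemma cycle_map_additive : zmod_morphism cycle_map.
Proof. by move=> x y; apply: val_inj; rewrite /= !raddfB. Qed.

HB.instance Definition _ :=
  GRing.isZmodMorphism.Build (ker d') (ker e') cycle_map cycle_map_additive.

Lemma cycle_map_comm x : cycle_map (to_cycles dd0 x) = to_cycles ee0 (phi x).
Proof. by apply: val_inj; rewrite /= comm. Qed.

Definition homology_map : {additive homology dd0 -> homology ee0} :=
  coker_map cycle_map_comm.

End HomologyMap.

(* Degrees 1, 2 and 3 of the inhomogeneous bar complex Z (x)_{Z[G]} B(G), with
   [a] [a|b] [a|b|c] rendered by the tuples a, (a, b) and (a, b, c). *)
Section BarComplex.
Variable G : groupType.

Definition bar1 : zmodType := {freeg G / int}.
Definition bar2 : zmodType := {freeg (G * G)%type / int}.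
Definition bar3 : zmodType := {freeg (G * G * G)%type / int}.

Definition bar_d2 : {additive bar2 -> bar1} :=
  zlift (fun '(a, b) => << b >> - << (a * b)%g >> + << a >> : bar1).

Definition bar_d3 : {additive bar3 -> bar2} :=
  zlift (fun '(a, b, c) =>
    << (b, c) >> - << ((a * b)%g, c) >> + << (a, (b * c)%g) >> - << (a, b) >>
    : bar2).

Lemma bar_dd0 x : bar_d2 (bar_d3 x) = 0.
Proof.
apply: (freeg_additive_ext (f := bar_d2 \o bar_d3) (g := \0)) x => -[[a b] c].
rewrite /= zliftU !(raddfB, raddfD) /= !zliftU mulgA.
apply/eqP/freeg_eqP => k; rewrite !(coeffB, coeffD) coeff0; ring.
Qed.

Definition H2 : zmodType := homology bar_dd0.

End BarComplex.

Section H2Map.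
Variables (G H : groupType) (f : {multiplicative G -> H}).

Definition bar1_map : {additive bar1 G -> bar1 H} :=
  zlift (fun a => << f a >> : bar1 H).

Definition bar2_map : {additive bar2 G -> bar2 H} :=
  zlift (fun '(a, b) => << (f a, f b) >> : bar2 H).

Definition bar3_map : {additive bar3 G -> bar3 H} :=
  zlift (fun '(a, b, c) => << (f a, f b, f c) >> : bar3 H).

Lemma bar_map_d3 x : bar2_map (bar_d3 G x) = bar_d3 H (bar3_map x).
Proof.
apply: (freeg_additive_ext (f := bar2_map \o bar_d3 G)
                           (g := bar_d3 H \o bar3_map)) x => -[[a b] c].
by rewrite /= !zliftU !(raddfB, raddfD) /= !zliftU !gmulfM.
Qed.

Lemma bar_map_d2 x : bar1_map (bar_d2 G x) = bar_d2 H (bar2_map x).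
Proof.
apply: (freeg_additive_ext (f := bar1_map \o bar_d2 G)
                           (g := bar_d2 H \o bar2_map)) x => -[a b].
by rewrite /= !zliftU !(raddfB, raddfD) /= !zliftU !gmulfM.
Qed.

Definition H2_map : {additive H2 G -> H2 H} :=
  homology_map (@bar_dd0 G) (@bar_dd0 H) bar_map_d3 bar_map_d2.

End H2Map.

Section Copairing.
Variables (A B C : zmodType) (f : {additive A -> C}) (g : {additive B -> C}).

Definition copair (x : A * B) : C := f x.1 + g x.2.

Lemma copair_additive : zmod_morphism copair.
Proof. by move=> x y; rewrite /copair !raddfB opprD addrACA. Qed.

HB.instance Definition _ :=
  GRing.isZmodMorphism.Build (A * B)%type C copair copair_additive.

End Copairing.

(* Main.v *)
(** Write F^ for the completion of F and R for the kernel of F -> G, and let R'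
    be the kernel of F^ -> G^, the closure of R. The connecting map
    H_2(G^) -> R'/[R',F^] has the image of H_2(F^) as its kernel; it maps H_2(G^)
    onto the classes of the elements of R' in [F^,F^], and the image of H_2(G)
    onto those of the elements of R in [F,F].

    As Q is the colimit of Z -> Z -> ... under multiplication by 1, 2, 3, ...,
    it is enough to solve y_n = (n+1) y_(n+1) + a_n in the cokernel for every
    sequence a. The class a_n is represented by some c_n in R' with c_n in
    [F^,F^], and changing c_n by an element of R in [F,F], which is dense in the
    intersection of R' and [F^,F^], moves c_n as deep as one likes in the lower
    central filtration. Then
    x_n = c_n (c_(n+1) (c_(n+2) ...)^(n+2))^(n+1) converges in F^, lies in R',
    and satisfies x_n = c_n x_(n+1)^(n+1) on the nose. Finally x_n is in
    [F^,F^], because for a finitely generated F this is the closed subgroup of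
    elements with trivial image in F/[F,F]; so x_n comes from some y_n. *)
Require Import Defs.
From HB Require Import structures.
From mathcomp Require Import all_boot all_order all_algebra.
From mathcomp Require Import boolp ring.
From mathcomp.multinomials Require Import freeg.

Set Implicit Arguments.
Unset Strict Implicit.
Unset Printing Implicit Defensive.

Import GRing.Theory Num.Theory.
Local Open Scope ring_scope.

(** * A criterion for cotorsion groups *)

Lemma freeg_int_ind (K : choiceType) (P : {freeg K / int} -> Prop) :
    P 0 -> (forall D E, P D -> P E -> P (D - E)) -> (forall k, P << k >>) ->
  forall D, P D.
Proof.
move=> P0 PB PU D.
have PN E : P E -> P (- E) by rewrite -[- E]add0r; exact: PB.
have PD E E' : P E -> P E' -> P (E + E').
  by move=> PE /PN; rewrite -{2}[E']opprK; exact: PB.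
have PMn E n : P E -> P (E *+ n).
  by move=> PE; elim: n => [|n IHn]; rewrite ?mulr0n // mulrS; exact: PD.
rewrite -[D]freeg_sumE; apply: big_ind => // k _.
rewrite -[coeff k D]intz -freegU_mulz; case: (coeff k D) => n.
  by rewrite -pmulrn; exact: PMn.
by rewrite NegzE mulrNz; apply/PN/PMn.
Qed.

Lemma mulrzMn (V : zmodType) (v : V) (m : int) n : v *~ (m *+ n) = v *+ n *~ m.
Proof. by rewrite -mulr_natl mulrzA mulrz_nat. Qed.

(** The chains [1/n!] and the relations [1/n!] - (n+1)[1/(n+1)!] present Q; solving for the values
    of [f] on these relations prescribes an extension of [f] to Z[Q]. *)
Lemma telescope_cotorsion (A : zmodType) :
    (forall c : nat -> A, exists y : nat -> A,
       forall n, y n = y n.+1 *+ n.+1 + c n) ->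
  cotorsion A.
Proof.
move=> solve x; have [f <-] := to_coker_surj x; apply/to_coker_eq0.
pose cover := free_cover rat; pose rel := relations rat.
(* [insubd] sends chains that are not relations to 0, which makes [fext] total; additivity is
   claimed on relations only. *)
pose fa : {additive rel -> A} := f; pose fext D := fa (insubd 0 D).
have fextE (r : rel) : fext (ker_val r) = fa r.
  by congr (fa _); exact: valKd.
have fextB D E : cover D = 0 -> cover E = 0 -> fext (D - E) = fext D - fext E.
  move=> /eqP D0 /eqP E0; pose d : rel := Ker D0; pose e : rel := Ker E0.
  by rewrite -[D - E]/(ker_val (d - e)) fextE raddfB -!fextE.
have fextD D E : cover D = 0 -> cover E = 0 -> fext (D + E) = fext D + fext E.
  move=> /eqP D0 /eqP E0; pose d : rel := Ker D0; pose e : rel := Ker E0.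
  by rewrite -[D + E]/(ker_val (d + e)) fextE raddfD -!fextE.
have fextMz D (m : int) : cover D = 0 -> fext (D *~ m) = fext D *~ m.
  move=> /eqP D0; pose d : rel := Ker D0.
  by rewrite -[D]/(ker_val d) -raddfMz !fextE raddfMz.
have fext0 : fext 0 = 0 := etrans (fextE 0) (raddf0 fa).
have coverU q : cover << q >> = q by exact: zliftU.
pose u n : {freeg rat / int} := << (n`!%:R)^-1 >>.
have coverZ n m : cover (u n *~ m) = m%:~R / n`!%:R.
  by rewrite raddfMz coverU mulrzl.
have step0 n : cover (u n - u n.+1 *+ n.+1) = 0.
  rewrite raddfB raddfMn !coverU -[_ *+ n.+1]mulr_natl factS natrM invfM.
  by rewrite mulVKf ?subrr // pnatr_eq0.
(* The extension of f sends a chain D over m / n! to y_n m + f(D - m [1/n!]);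
   the equations solved by y make this independent of n. *)
have [y yE] := solve (fun n => fext (u n - u n.+1 *+ n.+1)).
pose psi n D m := y n *~ m + fext (D - u n *~ m).
pose R n D (m : int) := cover D = m%:~R / n`!%:R.
have R0 n D m : R n D m -> cover (D - u n *~ m) = 0.
  by move=> Dm; rewrite raddfB coverZ Dm subrr.
(* Raising the denominator n! to (n+k)! does not change [psi], so two chains can be compared over a
   common denominator. *)
have lift n D m : R n D m ->
    forall k, exists m', R (n + k)%N D m' /\ psi (n + k)%N D m' = psi n D m.
  move=> Dm; elim=> [|k [m' [Dm' psim']]]; first by exists m; rewrite addn0.
  exists (m' *+ (n + k).+1); rewrite addnS; set j := (n + k)%N in Dm' psim' *.
  have Dj : R j.+1 D (m' *+ j.+1).
    rewrite /R Dm' rmorphMn /= -[_ *+ j.+1]mulr_natl factS natrM invfM.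
    by rewrite mulrACA mulfV ?mul1r // pnatr_eq0.
  split=> //; rewrite -psim' /psi [y j]yE mulrzDl -addrA; congr (_ + _).
    exact: mulrzMn.
  rewrite -fextMz // -fextD ?R0 //; last by rewrite raddfMz step0 mul0rz.
  by congr fext; rewrite mulrzMn mulrzBl [RHS]addrC addrA subrK.
have RB n D E m k : R n D m -> R n E k -> R n (D - E) (m - k).
  by rewrite /R raddfB => -> ->; rewrite intrB mulrBl.
have psiB n D E m k : R n D m -> R n E k ->
    psi n (D - E) (m - k) = psi n D m - psi n E k.
  move=> Dm Ek; rewrite /psi mulrzBr opprD addrACA -fextB ?R0 //.
  by congr (_ + fext _); rewrite mulrzBr !opprD !opprK addrACA.
have /choice[nm nmR] (q : rat) : exists nm, R nm.1 << q >> nm.2.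
  have [m [d ->]] : exists m d, q = m%:~R / d.+1%:R.
    exists (numq q); rewrite -{1}(divq_num_den q); have := denq_gt0 q.
    by case: (denq q) => [[|d]|] // _; exists d.
  exists (d.+1, m * (d`!)%:Z); rewrite /R /= coverU factS natrM intrM.
  by rewrite -mulf_div divff ?mulr1 // pnatr_eq0 -lt0n fact_gt0.
pose g : {additive {freeg rat / int} -> A} :=
  zlift (fun q => psi (nm q).1 << q >> (nm q).2).
have gE D : exists n m, R n D m /\ g D = psi n D m.
  elim/freeg_int_ind: D => [|D E [n [m [Dm gD]]] [n' [m' [Em' gE]]]|q].
  - exists 0%N, 0; split; first by rewrite /R raddf0 mul0r.
    by rewrite raddf0 /psi !mulr0z subr0 add0r fext0.
  - have [k [Dk psiD]] := lift _ _ _ Dm n'.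
    have [k' [Ek' psiE]] := lift _ _ _ Em' n; rewrite addnC in Ek' psiE.
    exists (n + n')%N, (k - k'); split; first exact: RB.
    by rewrite raddfB gD gE -psiD -psiE psiB.
  - by exists (nm q).1, (nm q).2; split; [exact: nmR | exact: zliftU].
exists (to_homZ g); apply: val_inj; apply/funext => r /=.
have [n [m [Dm ->]]] := gE (ker_val r).
(* A relation has value 0 in Q, so [psi] reduces to [f] on it. *)
have m0 : m = 0.
  move/eqP: Dm; rewrite /cover ker_valK eq_sym mulf_eq0 invr_eq0 pnatr_eq0.
  by rewrite eqn0Ngt fact_gt0 orbF intr_eq0 => /eqP.
by rewrite /psi m0 !mulr0z subr0 add0r fextE.
Qed.

(** * Hopf's relation in the bar complex *)

Lemma gmorphX (G H : groupType) (f : {multiplicative G -> H}) x n :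
  f (x ^+ n)%g = (f x ^+ n)%g.
Proof. by elim: n => [|n IHn]; rewrite ?gmorph1 // !expgS gmulfM IHn. Qed.

Lemma bar_d2U (G : groupType) (a b : G) :
  bar_d2 G << (a, b) >> = << b >> - << (a * b)%g >> + << a >>.
Proof. exact: zliftU. Qed.

Lemma bar_d3U (G : groupType) (a b c : G) :
  bar_d3 G << (a, b, c) >> =
  << (b, c) >> - << ((a * b)%g, c) >> + << (a, (b * c)%g) >> - << (a, b) >>.
Proof. exact: zliftU. Qed.

Lemma bar1_mapU (G H : groupType) (f : {multiplicative G -> H}) a :
  bar1_map f << a >> = << f a >>.
Proof. exact: zliftU. Qed.

Lemma bar2_mapU (G H : groupType) (f : {multiplicative G -> H}) a b :
  bar2_map f << (a, b) >> = << (f a, f b) >>.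
Proof. exact: zliftU. Qed.

Lemma H2_map_cycle (G H : groupType) (f : {multiplicative G -> H})
    (z : ker (bar_d2 G)) :
  H2_map f (to_coker _ z) = to_coker _ (Defs.cycle_map (bar_map_d2 f) z).
Proof. exact: coker_mapE. Qed.

Section HopfRelation.
Variables (E Q : groupType) (f : {multiplicative E -> Q}).

(* The chain u of E bounds a 2-chain of E lying over z modulo boundaries. The
   multiple of [1|1] is the defect of working in the unnormalised complex. *)
Definition spans (z : bar2 Q) (u : bar1 E) : Prop :=
  exists w t (m : int),
    bar_d2 E w = u /\ bar2_map f w = z + bar_d3 Q t + << (1%g, 1%g) >> *~ m.

Lemma spans0 : spans 0 0.
Proof. by exists 0, 0, 0; rewrite !raddf0 !addr0. Qed.

Lemma spansB z z' u u' :
  spans z u -> spans z' u' -> spans (z - z') (u - u').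
Proof.
move=> [w [t [m [<- wE]]]] [w' [t' [m' [<- wE']]]].
exists (w - w'), (t - t'), (m - m'); rewrite !raddfB wE wE'; split=> //.
by rewrite opprD addrACA; congr (_ + _); rewrite opprD addrACA.
Qed.

Lemma spansN z u : spans z u -> spans (- z) (- u).
Proof.
by move=> zu; rewrite -[- z]add0r -[- u]add0r; exact: spansB spans0 zu.
Qed.

Lemma spansD z z' u u' :
  spans z u -> spans z' u' -> spans (z + z') (u + u').
Proof.
by move=> zu /spansN; rewrite -{2}[z']opprK -{2}[u']opprK; exact: spansB.
Qed.

Lemma spans_bar a b :
  spans << (f a, f b) >> (<< b >> - << (a * b)%g >> + << a >>).
Proof.
exists << (a, b) >>, 0, 0.
by rewrite bar_d2U bar2_mapU !raddf0 !addr0.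
Qed.

(** The image [1|f y] of [x|y] is [1|1] plus the boundary of [1|1|f y]. *)
Lemma spans_degenerate x y :
  f x = 1%g -> spans 0 (<< y >> - << (x * y)%g >> + << x >>).
Proof.
move=> fx; exists << (x, y) >>, << (1%g, 1%g, f y) >>, 1.
rewrite bar_d2U bar2_mapU bar_d3U !mul1g fx; split=> //.
by rewrite mulr1z add0r addrAC addrK subrK.
Qed.

Lemma spans1 : spans 0 << 1%g >>.
Proof.
have := @spans_degenerate 1%g 1%g (gmorph1 f).
by rewrite mulg1 subrr add0r.
Qed.

Lemma spans_div x y : f x = 1%g -> f y = 1%g ->
  spans 0 (<< (x / y)%g >> - (<< x >> - << y >>)).
Proof.
move=> fx fy; have := @spans_degenerate (x / y)%g y.
rewrite gmulfM gmorphV fx fy mulgV mulgVK => /(_ erefl).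
by rewrite opprB addrC.
Qed.

(** Lifting each [a|b] to [s a|s b] costs one kernel element, and [spans_div] collects these into a
    single [x]. For a cycle [z] the section term vanishes. *)
Lemma spans_section (s : Q -> E) : (forall q, f (s q) = q) -> forall z,
  exists2 x, f x = 1%g &
    spans z (zlift (fun q => << s q >> : bar1 E) (bar_d2 Q z) + << x >>).
Proof.
move=> fs; elim/freeg_int_ind => [|z z' [x fx zx] [x' fx' zx']|[a b]].
- by exists 1%g; rewrite ?gmorph1 // !raddf0 add0r; exact: spans1.
- exists (x / x')%g; first by rewrite gmulfM gmorphV fx fx' mulgV.
  have := spansD (spansB zx zx') (spans_div fx fx').
  rewrite !raddfB addr0 /= => H; congr (spans _ _) : H.
  by apply/eqP/freeg_eqP => k; rewrite !(coeffB, coeffD); ring.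
(* The factor set of [s]: up to degenerate chains, the boundary of [s a|s b] differs by -[g], that
   is by [g^-1], from the lifted boundary of [a|b]. *)
pose g := (s a * s b / s (a * b))%g.
have fg : f g = 1%g by rewrite /g !gmulfM gmorphV !fs mulgV.
exists g^-1%g; first by rewrite gmorphV fg invg1.
have := spans_bar (s a) (s b); rewrite !fs => Hab.
have := spans_degenerate (s (a * b)%g) fg; rewrite /g mulgVK -/g => Hg.
have := spans_div (gmorph1 f) fg; rewrite div1g => Hi.
have := spansD (spansB Hab Hg) (spansD Hi spans1).
rewrite subr0 !addr0 => H; congr (spans _ _) : H.
pose sl : {additive bar1 Q -> bar1 E} := zlift (fun q => << s q >> : bar1 E).
have slU q : sl << q >> = << s q >> by exact: zliftU.
rewrite bar_d2U -[zlift _ _]/(sl _) (raddfD sl) (raddfB sl) !slU.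
apply/eqP/freeg_eqP => k; rewrite !(coeffB, coeffD); ring.
Qed.

Lemma bar_d2_one : bar_d2 E << (1%g, 1%g) >> = << 1%g >>.
Proof. by rewrite bar_d2U mulg1 subrr add0r. Qed.

End HopfRelation.

Lemma bar1_one_mulz_eq0 (G : groupType) (m : int) :
  << 1%g >> *~ m = 0 :> bar1 G -> m = 0.
Proof.
by rewrite freegU_mulz => /eqP; rewrite freegU_eq0 intz => /eqP.
Qed.

(** The elements [x] for which [x] bounds form a subgroup, so commutators suffice. *)
Lemma bar_d2_lcs1 (G : groupType) (x : G) :
  x \in lcs G 1 -> exists w, bar_d2 G w = << x >>.
Proof.
pose S : {pred G} := [pred x | `[< exists w, bar_d2 G w = << x >> >]].
have gS : group_closed S.
  split=> [|a b /asboolP[v vE] /asboolP[w wE]].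
    by apply/asboolP; exists << (1%g, 1%g) >>; exact: bar_d2_one.
  apply/asboolP; exists (<< ((a / b)%g, b) >> + v - w).
  rewrite raddfB raddfD bar_d2U vE wE mulgVK.
  by apply/eqP/freeg_eqP => k; rewrite !(coeffB, coeffD); ring.
move=> /generatedP/(_ S gS) xS; apply/asboolP/xS.
move=> _ /asboolP[a [b [_ _ ->]]]; apply/asboolP.
(* The identity a b = (b a)[a,b], with both products split by [a|b] and [b|a]. *)
exists (<< ((b * a)%g, [~ a, b]%g) >> - << (a, b) >> + << (b, a) >>).
rewrite raddfD raddfB !bar_d2U -commgC.
by apply/eqP/freeg_eqP => k; rewrite !(coeffB, coeffD); ring.
Qed.

Section AdditiveNotation.
Variables (A : groupType) (comA : forall a b : A, commute a b).

Definition additive_of : Type := let _ := comA in A.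

HB.instance Definition _ := Choice.on additive_of.
HB.instance Definition _ :=
  GRing.isZmodule.Build additive_of (@mulgA A) comA (@mul1g A) (@mulVg A).

End AdditiveNotation.

Section HopfClass.
Variables (E Q : groupType) (f : {multiplicative E -> Q}).

(* The connecting map H_2(Q) -> N/[N,E], for N the kernel of f, as a relation
   between a homology class and the representatives x in N of its image. *)
Definition hopf_class (zeta : H2 Q) (x : E) : Prop :=
  exists z, to_coker _ z = zeta /\ spans f (ker_val z) << x >>.

Lemma hopf_class_exists (s : Q -> E) : (forall q, f (s q) = q) ->
  forall zeta, exists2 x, f x = 1%g & hopf_class zeta x.
Proof.
move=> fs zeta; have [z <-] := to_coker_surj zeta.
have [x fx] := spans_section fs (ker_val z); rewrite ker_valK raddf0 add0r.
by move=> zx; exists x => //; exists z.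
Qed.

(** A chain of [E] bounded by [x] maps to one bounded by [1]; subtracting [1|1] makes it a cycle. *)
Lemma hopf_class_lcs1 x :
  x \in lcs E 1 -> f x = 1%g -> exists zeta, hopf_class zeta x.
Proof.
move=> /bar_d2_lcs1[w wE] fx.
have zP : bar2_map f w - << (1%g, 1%g) >> \in ker_pred (bar_d2 Q).
  rewrite inE raddfB -bar_map_d2 wE bar1_mapU fx bar_d2U mulg1 subrr add0r.
  by rewrite subrr.
exists (to_coker _ (Ker zP)), (Ker zP); split=> //.
by exists w, 0, 1; rewrite raddf0 addr0 mulr1z subrK.
Qed.

Lemma hopf_classB zeta xi x y : f x = 1%g -> f y = 1%g ->
  hopf_class zeta x -> hopf_class xi y -> hopf_class (zeta - xi) (x / y)%g.
Proof.
move=> fx fy [z [<- zx]] [v [<- vy]]; exists (z - v); split.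
  by rewrite raddfB.
have := spansD (spansB zx vy) (spans_div fx fy).
rewrite addr0 [X in spans f _ X]addrC subrK => H.
by rewrite (_ : ker_val (z - v) = ker_val z - ker_val v) //; exact: raddfB.
Qed.

Lemma hopf_class0 : hopf_class 0 1%g.
Proof. by exists 0; split; [exact: raddf0 | exact: spans1]. Qed.

Lemma hopf_classMn zeta x n : f x = 1%g ->
  hopf_class zeta x -> hopf_class (zeta *+ n) (x ^+ n)%g.
Proof.
move=> fx zx; elim: n => [|n IHn]; first exact: hopf_class0.
have fxn : f (x ^+ n)%g = 1%g by rewrite gmorphX fx expg1n.
have -> : zeta *+ n.+1 = zeta - (0 - zeta *+ n) by rewrite sub0r opprK mulrS.
have -> : (x ^+ n.+1 = x / (1 / x ^+ n))%g by rewrite div1g invgK expgS.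
apply: hopf_classB => //; first by rewrite div1g gmorphV fxn invg1.
by apply: hopf_classB => //; [exact: gmorph1 | exact: hopf_class0].
Qed.

(** Exactness at H_2(Q): [w] has boundary [1], so w - [1|1] is a cycle of [E], and it lies over [z]
    up to a boundary. *)
Lemma hopf_class1 zeta : hopf_class zeta 1%g -> exists eta, H2_map f eta = zeta.
Proof.
move=> [z [<- [w [t [m [wE wm]]]]]].
have vP : w - << (1%g, 1%g) >> \in ker_pred (bar_d2 E).
  by rewrite inE raddfB wE bar_d2U mulg1 subrr add0r subrr.
(* Taking boundaries in [wm] gives [1] = m[1]. *)
have m1 : m = 1.
  apply/eqP; rewrite -subr_eq0; apply/eqP/(@bar1_one_mulz_eq0 Q).
  have := congr1 (bar_d2 Q) wm.
  rewrite -bar_map_d2 wE bar1_mapU gmorph1 !(raddfD (bar_d2 Q)) bar_dd0.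
  rewrite ker_valK !add0r raddfMz bar_d2U mulg1 subrr add0r => E1.
  by rewrite mulrzBr mulr1z -E1 subrr.
exists (to_coker _ (Ker vP)); rewrite H2_map_cycle; apply/eqP.
rewrite -subr_eq0 -raddfB; apply/eqP/to_coker_eq0; exists t.
apply: val_inj => /=.
rewrite raddfB wm m1 bar2_mapU !gmorph1 mulr1z addrK.
by rewrite addrAC subrr add0r.
Qed.

(** The linear extension of [phi] to 1-chains kills boundaries, and [x] is one. *)
Lemma hopf_class_commutative (A : groupType) (phi : {multiplicative E -> A})
    zeta x :
  (forall a b : A, commute a b) -> hopf_class zeta x -> phi x = 1%g.
Proof.
move=> comA [z [_ [w [_ [_ [wE _]]]]]].
pose phiA : {additive bar1 E -> additive_of comA} :=
  @zlift E (additive_of comA) phi.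
have phiU a : phiA << a >> = phi a by exact: zliftU.
rewrite -phiU -wE.
have phi0 : phiA \o bar_d2 E =1 \0; last exact: phi0.
apply: freeg_additive_ext => -[a b] /=.
rewrite bar_d2U raddfD raddfB !phiU gmulfM.
change (phi b / (phi a * phi b) * phi a = 1)%g.
by rewrite invgM mulVKg mulVg.
Qed.

End HopfClass.

Lemma hopf_class_map (E E' Q Q' : groupType)
    (f : {multiplicative E -> Q}) (f' : {multiplicative E' -> Q'})
    (e : {multiplicative E -> E'}) (q : {multiplicative Q -> Q'}) zeta x :
    (forall a, f' (e a) = q (f a)) ->
  hopf_class f zeta x -> hopf_class f' (H2_map q zeta) (e x).
Proof.
move=> fe [z [<- [w [t [m [wE wm]]]]]].
eexists; split; first by rewrite H2_map_cycle.
exists (bar2_map e w), (bar3_map q t), m; split.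
  by rewrite -bar_map_d2 wE bar1_mapU.
have bar2_comp v : bar2_map f' (bar2_map e v) = bar2_map q (bar2_map f v).
  apply: (freeg_additive_ext (f := bar2_map f' \o bar2_map e)
                             (g := bar2_map q \o bar2_map f)) => -[a b] /=.
  by rewrite !bar2_mapU !fe.
rewrite bar2_comp wm !(raddfD (bar2_map q)) bar_map_d3.
by rewrite (raddfMz (bar2_map q)) bar2_mapU !gmorph1.
Qed.

(** * Commutators modulo the lower central series *)

Lemma gmorph_prod (G H : groupType) (f : {multiplicative G -> H}) (I : Type)
    (s : seq I) (x : I -> G) :
  (f (\prod_(i <- s) x i) = \prod_(i <- s) f (x i))%g.
Proof. by rewrite (big_morph f (@gmulfM _ _ f) (gmorph1 f)). Qed.

Section ProjectionMorphism.
Local Open Scope group_scope.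
Variables (G : groupType) (N : normalClosed G).

Lemma projgM x y : projg N (x * y) = projg N x * projg N y.
Proof. exact: gmulfM. Qed.

Lemma projgV x : projg N x^-1 = (projg N x)^-1.
Proof. exact: gmorphV. Qed.

End ProjectionMorphism.

Section LowerCentralQuotients.
Local Open Scope group_scope.
Variable G : groupType.

Lemma projg_eq1 (N : normalClosed G) x : (projg N x = 1) <-> (x \in N).
Proof. by rewrite -(gmorph1 (projg N)) projg_eq divg1. Qed.

Lemma mem_lcsR i x y : x \in lcs G i -> [~ x, y] \in lcs G i.+1.
Proof. by move=> xi; apply/sub_generated/asboolP; exists x, y. Qed.

Lemma commute_projg_lcs i x (a : nilquot G i.+1) :
  x \in lcs G i -> commute (projg (lcs G i.+1) x) a.
Proof.
move=> xi; have [y <-] := projg_surj a.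
by apply/commgP; rewrite -gmorphR; apply/eqP/projg_eq1/mem_lcsR.
Qed.

Lemma nilquot1_commute (a b : nilquot G 1) : commute a b.
Proof. by have [x <-] := projg_surj a; exact: commute_projg_lcs. Qed.

Local Notation pr i := (projg (lcs G i.+2)).

(** [u,g] is central modulo [lcs G i.+2], which removes the conjugation from [uv,g] = [u,g]^v
    [v,g]. *)
Lemma pr_commMl i u v g : u \in lcs G i ->
  pr i [~ u * v, g] = pr i [~ u, g] * pr i [~ v, g].
Proof.
move=> ui; have -> : [~ u * v, g] = [~ u, g] ^ v * [~ v, g].
  by rewrite !commgEl !conjgE !invgM !mulgA !mulgK.
have uR := commute_projg_lcs _ (mem_lcsR g ui).
by rewrite gmulfM gmorphJ conjgE (uR (pr i v)) mulKg.
Qed.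

Lemma pr_commMr i u g h : u \in lcs G i ->
  pr i [~ u, g * h] = pr i [~ u, g] * pr i [~ u, h].
Proof.
move=> ui; have -> : [~ u, g * h] = [~ u, h] * [~ u, g] ^ h.
  by rewrite !commgEl !conjgE !invgM !mulgA !mulgK.
have uR x a : commute (pr i [~ u, x]) a.
  exact/commute_projg_lcs/mem_lcsR.
by rewrite gmulfM gmorphJ conjgE (uR g (pr i h)) mulKg (uR h).
Qed.

Lemma pr_commBr i u g h : u \in lcs G i ->
  pr i [~ u, g / h] = pr i [~ u, g] / pr i [~ u, h].
Proof.
by move=> ui; apply: (mulIg (pr i [~ u, h])); rewrite mulgVK -pr_commMr ?mulgVK.
Qed.

Lemma prodg_single (H : groupType) (I : eqType) (s : seq I) j (h : H) :
  uniq s -> j \in s -> \prod_(i <- s) (if i == j then h else 1) = h.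
Proof.
elim: s => [//|i s IHs] /= /andP[si us]; rewrite inE big_cons eq_sym.
have [-> _|_ /= sj] := eqVneq j i; last by rewrite mul1g IHs.
rewrite big_seq big1 ?mulg1 // => k ks.
by rewrite ifN //; apply: contraNneq si => <-.
Qed.

(** Bilinearity of the commutator modulo [lcs G i.+2] reduces the claim first to single commutators
    [a,g], then to [g] in [s]. *)
Lemma lcs_comm_generators (s : seq G) i z : uniq s ->
    (forall x, x \in subgroup_generated (mem s)) -> z \in lcs G i.+1 ->
  exists2 u : G -> G, (forall e, u e \in lcs G i) &
    pr i z = \prod_(e <- s) pr i [~ u e, e].
Proof.
move=> us sG.
have prB x y : pr i (x / y) = pr i x / pr i y by rewrite projgM projgV.
pose T : {pred G} := [pred z | `[< exists2 u : G -> G,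
  (forall e, u e \in lcs G i) & pr i z = \prod_(e <- s) pr i [~ u e, e] >]].
have gT : group_closed T.
  split=> [|a b /asboolP[u ui aE] /asboolP[v vi bE]]; apply/asboolP.
    exists (fun=> 1) => [e|]; first exact: gpred1.
    by rewrite big1 ?gmorph1 // => e _; rewrite comm1g gmorph1.
  exists (fun e => u e / v e) => [e|]; first by rewrite gpredM ?gpredVr.
  rewrite prB; apply: (mulIg (pr i b)); rewrite mulgVK bE -prodgM_commute.
    rewrite aE; apply: eq_bigr => e _.
    by rewrite -pr_commMl ?mulgVK ?gpredM ?gpredVr.
  by move=> e h _ _; apply/commute_projg_lcs/mem_lcsR; rewrite gpredM ?gpredVr.
move=> /generatedP/(_ T gT) zT; apply/asboolP/zT => {zT}.
move=> _ /asboolP[a [g [ai _ ->]]].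
pose S : {pred G} := [pred g | [~ a, g] \in T].
have inS h : (h \in S) = ([~ a, h] \in T) by [].
have TE x y : pr i x = pr i y -> (x \in T) = (y \in T).
  by move=> xy; rewrite !inE xy.
rewrite -[_ \in _]inS; move/generatedP: (sG g); apply.
  split=> [|x y]; rewrite !inS; first by rewrite commg1; case: gT.
  move=> xT yT; rewrite (TE _ ([~ a, x] / [~ a, y])); first exact: gT.2.
  by rewrite pr_commBr // prB.
move=> e es; rewrite inS; apply/asboolP.
exists (fun x => if x == e then a else 1) => [x|].
  by case: ifP => _ //; exact: gpred1.
rewrite -(prodg_single (pr i [~ a, e]) us es).
by apply: eq_bigr => x _; case: eqP => [->|_] //; rewrite comm1g gmorph1.
Qed.

End LowerCentralQuotients.

(** * Approximation in the completion *)

Section Subgroup.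
Variables (G : groupType) (S : groupClosed G).

Record subgroup := Subgroup { subgroup_val : G; _ : subgroup_val \in S }.

HB.instance Definition _ := [isSub for subgroup_val].
HB.instance Definition _ := [Choice of subgroup by <:].

Lemma mem_group_closed : group_closed S.
Proof. by split=> [|x y xS yS]; rewrite ?gpred1 // gpredM ?gpredVr. Qed.

HB.instance Definition _ :=
  SubChoice_isSubGroup.Build G (S : {pred G}) subgroup mem_group_closed.

Lemma subgroup_val_multiplicative : {morph subgroup_val : x y / (x * y)%g}.
Proof. exact: valM. Qed.

HB.instance Definition _ :=
  isMultiplicative.Build subgroup G subgroup_val subgroup_val_multiplicative.

End Subgroup.

(** The basis extends to a morphism into the subgroup it generates; followed by the inclusion, it is
    the identity by uniqueness. *)
Lemma free_of_finite_rank_generated (F : groupType) :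
  free_of_finite_rank F -> finitely_generated F.
Proof.
move=> [n [b bF]]; exists (codom b) => x.
pose S := subgroup_generated (mem (codom b)).
have bS i : b i \in S by apply: sub_generated; exact: codom_f.
have [[r rb] _] := bF (subgroup S) (fun i => Subgroup (bS i)).
have [_ bF1] := bF F b.
have <- : subgroup_val (r x) = x; last exact: (valP (r x)).
by apply: (bF1 (@subgroup_val _ _ \o r) idfun) => // i; rewrite /= rb.
Qed.

Section CompletionElements.
Local Open Scope group_scope.
Variable G : groupType.
Implicit Types x y : completion G.

Lemma coordM x y i : (x * y) i = x i * y i. Proof. by []. Qed.
Lemma coordV x i : x^-1 i = (x i)^-1. Proof. by []. Qed.

Definition coord_at i x : nilquot G i := x i.

HB.instance Definition _ i :=
  isMultiplicative.Build (completion G) (nilquot G i) (coord_at i)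
    (fun x y => erefl).

Lemma coord_projg_le x g i j :
  (i <= j)%N -> x j = projg (lcs G j) g -> x i = projg (lcs G i) g.
Proof.
move=> /subnK <-; elim: (j - i)%N => [//|k IHk] xk; apply: IHk.
by rewrite -(coord_compat x) xk projg_compat.
Qed.

Lemma completion_of_sequence (g : nat -> G) :
    (forall i, projg (lcs G i) (g i.+1) = projg (lcs G i) (g i)) ->
  exists x : completion G, forall i, x i = projg (lcs G i) (g i).
Proof.
move=> gS; have gP i :
    nilquot_trans (projg (lcs G i.+1) (g i.+1)) = projg (lcs G i) (g i).
  by rewrite projg_compat gS.
by exists (Completion gP).
Qed.

End CompletionElements.

Lemma dependent_choice (T : Type) (R : nat -> T -> T -> Prop)
    (P : nat -> T -> Prop) x0 : P 0%N x0 ->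
    (forall n x, P n x -> exists2 y, P n.+1 y & R n x y) ->
  exists f : nat -> T, forall n, P n (f n) /\ R n (f n) (f n.+1).
Proof.
move=> P0 step.
have /choice[h hP] n :
    exists hn : T -> T, forall x, P n x -> P n.+1 (hn x) /\ R n x (hn x).
  suff /choice[h hP] x : exists y, P n x -> P n.+1 y /\ R n x y by exists h.
  have [/step[y Py Ry]|nP] := pselect (P n x); first by exists y.
  by exists x0.
pose f := fix f n := if n is m.+1 then h m (f m) else x0.
have fP n : P n (f n) by elim: n => [|n /hP[]].
by exists f => n; split; [exact: fP | have [] := hP n _ (fP n)].
Qed.

Lemma lcs_lift (F G : groupType) (p : {multiplicative F -> G}) i y :
    (forall g, exists x, p x = g) -> y \in lcs G i ->
  exists2 x, x \in lcs F i & p x = y.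
Proof.
move=> p_surj; elim: i y => [|i IHi] y.
  by have [x <-] := p_surj y; exists x.
pose S : {pred G} := [pred y | `[< exists2 x, x \in lcs F i.+1 & p x = y >]].
have gS : group_closed S.
  split=> [|_ _ /asboolP[u ui <-] /asboolP[v vi <-]]; apply/asboolP.
    by exists 1%g; rewrite ?gmorph1 ?gpred1.
  by exists (u / v)%g; rewrite ?gmulfM ?gmorphV // gpredM ?gpredVr.
move=> /generatedP/(_ S gS) yS; apply/asboolP/yS.
move=> _ /asboolP[a [b [/IHi[u ui <-] _ ->]]]; have [v <-] := p_surj b.
by apply/asboolP; exists [~ u, v]%g; rewrite ?gmorphR ?mem_lcsR.
Qed.

Section Surjection.
Local Open Scope group_scope.
Variables (F G : groupType) (p : {multiplicative F -> G}).
Hypothesis p_surj : forall g, exists x, p x = g.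

(** Coordinates are lifted successively: a lift [u] at level i errs at the next level by an element
    of [lcs G i], corrected by some [h] in [lcs F i], which leaves level i unchanged. *)
Lemma completion_map_surj y : exists x, completion_map p x = y.
Proof.
have [g gP] : exists g : nat -> F, forall i,
    y i = projg (lcs G i) (p (g i)) /\
    projg (lcs F i) (g i.+1) = projg (lcs F i) (g i).
  have [a ya] := projg_surj (y 0%N); have [x px] := p_surj a.
  apply: (@dependent_choice _
    (fun i u v => projg (lcs F i) v = projg (lcs F i) u)
    (fun i u => y i = projg (lcs G i) (p u)) x); first by rewrite px ya.
  move=> i u yi; have [b yb] := projg_surj (y i.+1); have [v pv] := p_surj b.
  have : p u^-1 * b \in lcs G i.
    apply/projg_eq1; rewrite gmorphV projgM projgV -yi.
    by rewrite -(coord_projg_le (leqnSn i) (esym yb)) mulVg.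
  case/(lcs_lift p_surj) => h hi ph; exists (u * h).
    by rewrite gmulfM ph gmorphV mulVKg yb.
  by rewrite projgM ((projg_eq1 _ h).2 hi) mulg1.
have [x xE] := completion_of_sequence (fun i => (gP i).2).
exists x; apply: completion_ext => i.
rewrite (gP i).1 /= xE; exact: quotg_mapE.
Qed.

(** A representative [g] of [c k] has [p g] in [lcs G k]; dividing by a preimage in [lcs F k] moves
    it into the kernel. Thus the kernel of [p] is dense in that of the completed map. *)
Lemma kernel_approximation (c : completion F) k :
    completion_map p c = 1 ->
  exists2 r, p r = 1 & c k = projg (lcs F k) r.
Proof.
move=> pc; have [g cg] := projg_surj (c k).
have : p g \in lcs G k.
  apply/projg_eq1; rewrite -(quotg_mapE (@lcs_morph F G p k)) cg.
  exact: (congr1 (@coord_at G k) pc).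
case/(lcs_lift p_surj) => h hk ph; exists (g / h).
  by rewrite gmulfM gmorphV ph mulgV.
by rewrite projgM projgV ((projg_eq1 _ h).2 hk) invg1 mulg1.
Qed.

End Surjection.

(* If s generates G then x is the product of the commutators [y_e, e], e in s,
   where the y_e are found by successive approximation along the lower central
   filtration. *)
Lemma completion_lcs1 (G : groupType) (x : completion G) :
  finitely_generated G -> x 1%N = 1%g -> x \in lcs (completion G) 1.
Proof.
move=> [s0 sG0] x1; pose s := undup s0.
have us : uniq s := undup_uniq s0.
have sG g : g \in subgroup_generated (mem s).
  apply/generatedP => H gH sH; move/generatedP: (sG0 g); apply=> // e es.
  by apply: sH; move: es; rewrite -(mem_undup s0).
have [a aP] : exists a : nat -> G -> G, forall i,
    x i.+1 = (\prod_(e <- s) projg (lcs G i.+1) [~ a i e, e])%g /\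
    forall e, projg (lcs G i) (a i.+1 e) = projg (lcs G i) (a i e).
  apply: (@dependent_choice _
    (fun i (u v : G -> G) =>
       forall e, projg (lcs G i) (v e) = projg (lcs G i) (u e))
    (fun i (u : G -> G) =>
       x i.+1 = \prod_(e <- s) projg (lcs G i.+1) [~ u e, e])%g (fun=> 1%g)).
    by rewrite x1 big1 // => e _; rewrite comm1g gmorph1.
  move=> i v xv; have [z xz] := projg_surj (x i.+2).
  pose w := (\prod_(e <- s) [~ v e, e])%g.
  have prw j :
      projg (lcs G j) w = (\prod_(e <- s) projg (lcs G j) [~ v e, e])%g.
    by exact: gmorph_prod.
  (* The error of the current product [w] is, modulo [lcs G i.+2], a product of [u_e, e] with u_e in
     [lcs G i]; passing to u_e v_e corrects it and keeps v_e modulo [lcs G i]. *)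
  have : (z / w \in lcs G i.+1)%g.
    apply/projg_eq; rewrite prw -xv.
    by rewrite (coord_projg_le (leqnSn i.+1) (esym xz)).
  move=> /(lcs_comm_generators us sG)[u ui zwE].
  exists (fun e => u e * v e)%g => [|e]; last first.
    by rewrite projgM ((projg_eq1 _ _).2 (ui e)) mul1g.
  rewrite -xz -[z](mulgVK w) projgM zwE prw -prodgM_commute.
    by apply: eq_bigr => e _; rewrite pr_commMl.
  by move=> e h _ _; apply/commute_projg_lcs/mem_lcsR.
have /choice[y yP] e : exists y : completion G,
    forall i, y i = projg (lcs G i) (a i e).
  by apply: completion_of_sequence => i; exact: (aP i).2.
have -> : x = (\prod_(e <- s) [~ y e, to_completion e])%g.
  apply: completion_ext => i; rewrite -[RHS]/(coord_at i _) gmorph_prod.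
  (* The equation for [a i] lives at coordinate i+1, but [a i] gives y_e only at coordinate i, hence
     the descent. *)
  rewrite -(coord_compat x) (aP i).1 gmorph_prod.
  apply: eq_bigr => e _; apply: etrans (projg_compat [~ a i e, e]%g i) _.
  rewrite [LHS](gmorphR (projg (lcs G i))) [RHS](gmorphR (@coord_at G i)) /=.
  by rewrite /coord_at yP.
rewrite big_seq; apply: (big_ind (fun z => z \in lcs (completion G) 1)).
- exact: gpred1.
- by move=> u v; exact: gpredM.
- by move=> e _; exact: (@mem_lcsR _ 0).
Qed.

(** * The infinite product x_n = c_n x_(n+1)^(n+1) *)

Section Telescope.
Local Open Scope group_scope.
Variables (G : groupType) (c : nat -> completion G).
Hypothesis c_small : forall n i, (i <= n)%N -> c n i = 1.

(* The coordinate at i of c_n (c_(n+1) (...)^(n+2))^(n+1), cut off after k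
   factors. *)
Fixpoint telescope i k n : nilquot G i :=
  if k is k'.+1 then c n i * telescope i k' n.+1 ^+ n.+1 else 1.

Lemma telescopeS i k n :
  telescope i k.+1 n = c n i * telescope i k n.+1 ^+ n.+1.
Proof. by []. Qed.

(** The additional factor c_(n+k) is trivial at coordinate i. *)
Lemma telescope_stable i k n :
  (i <= n + k)%N -> telescope i k.+1 n = telescope i k n.
Proof.
elim: k n => [|k IHk] n ik.
  have cni : c n i = 1 by apply: c_small; rewrite -[n]addn0.
  by rewrite telescopeS cni mul1g; exact: expg1n.
have IH : telescope i k.+1 n.+1 = telescope i k n.+1.
  by apply: IHk; rewrite addSnnS.
by rewrite telescopeS IH.
Qed.

Lemma telescope_trans i k n :
  nilquot_trans (telescope i.+1 k n) = telescope i k n.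
Proof.
elim: k n => [|k IHk] n /=; first exact: gmorph1.
by rewrite gmulfM gmorphX [X in X * _]coord_compat [X in X ^+ _]IHk.
Qed.

(** Serves to place the limit in the kernel of the completed map, and to make its image in F/[F,F]
    trivial. *)
Lemma telescope_in (H : groupType) i (phi : {multiplicative nilquot G i -> H}) :
  (forall m, phi (c m i) = 1) -> forall k n, phi (telescope i k n) = 1.
Proof.
move=> phi_c; elim=> [|k IHk] n /=; first exact: gmorph1.
by rewrite gmulfM gmorphX phi_c IHk expg1n mulg1.
Qed.

Lemma telescope_compat n i :
  nilquot_trans (telescope i.+1 i.+1 n) = telescope i i n.
Proof. by rewrite telescope_trans telescope_stable // leq_addl. Qed.

Definition telescope_limit n : completion G := Completion (telescope_compat n).

Lemma telescope_limitE n :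
  telescope_limit n = c n * telescope_limit n.+1 ^+ n.+1.
Proof.
apply: completion_ext => i.
have -> : (c n * telescope_limit n.+1 ^+ n.+1) i = telescope i i.+1 n.
  by rewrite -[LHS]/(coord_at i _) gmulfM gmorphX.
by rewrite telescope_stable // leq_addl.
Qed.

End Telescope.

(** * Approximation of homology classes and the solution in the cokernel *)

Lemma completion_map_to_completion (F G : groupType)
    (p : {multiplicative F -> G}) a :
  completion_map p (to_completion a) = to_completion (p a).
Proof. by apply: completion_ext => i; exact: quotg_mapE. Qed.

(** A representative [d] of [zeta] is trivial in F/[F,F]; an [r] in the kernel of [p] close to [d]
    then lies in [F,F], so it represents some [xi], and d/r is the required [c]. *)
Lemma hopf_class_approximation (F G : groupType) (p : {multiplicative F -> G})
    (p_surj : forall g : G, exists x : F, p x = g) zeta n :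
  exists (xi : H2 G) (c : completion F),
    [/\ completion_map p c = 1%g, forall i, (i <= n.+1)%N -> c i = 1%g &
        hopf_class (completion_map p) (zeta - H2_map (@to_completion G) xi) c].
Proof.
have /choice[s sK] := completion_map_surj p_surj.
have [d pd zd] := hopf_class_exists sK zeta.
have d1 : d 1%N = 1%g.
  exact: (hopf_class_commutative (@coord_at F 1) (@nilquot1_commute F) zd).
(* Level n+1 rather than n ensures that [r] lies in [F,F] even for n = 0. *)
have [r pr dr] := kernel_approximation p_surj n.+1 pd.
have rd i : (i <= n.+1)%N -> d i = projg (lcs F i) r.
  by move=> /coord_projg_le; exact.
have r1 : r \in lcs F 1 by apply/projg_eq1; rewrite -rd.
have [xi xir] := hopf_class_lcs1 r1 pr.
have tc_r : completion_map p (to_completion r) = 1%g.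
  by rewrite completion_map_to_completion pr gmorph1.
exists xi, (d / to_completion r)%g; split=> [|i ni|].
- by rewrite gmulfM gmorphV pd [X in (_ / X)%g]tc_r invg1 mulg1.
- by rewrite coordM coordV (rd i) ?mulgV.
apply: hopf_classB => //.
by apply: hopf_class_map xir => a; exact: completion_map_to_completion.
Qed.

Theorem theoremB (G F : groupType) (p : {multiplicative F -> G})
    (fgG : finitely_generated G) (freeF : free_of_finite_rank F)
    (p_surj : forall g : G, exists x : F, p x = g) :
  cotorsion (coker (copair (H2_map (completion_map p))
                           (H2_map (@to_completion G)))).
Proof.
apply: telescope_cotorsion => a.
pose q : {multiplicative completion F -> completion G} := completion_map p.
have /choice[zeta zetaE] n := to_coker_surj (a n).
have /choice[xi /choice[c cP]] n := hopf_class_approximation p_surj (zeta n) n.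
have c_small n i : (i <= n)%N -> c n i = 1%g.
  by case: (cP n) => _ + _ ni; apply; exact: leqW.
pose x := telescope_limit c_small.
have qx n : q (x n) = 1%g.
  apply: completion_ext => i.
  apply: (telescope_in (phi := @nilquot_map _ _ p i)).
  by move=> m; case: (cP m) => /(congr1 (@coord_at G i)).
have x1 n : x n 1%N = 1%g.
  pose id1 : {multiplicative nilquot F 1 -> nilquot F 1} := idfun.
  rewrite -[LHS]/(id1 (telescope c 1 1 n)) telescope_in // => m.
  by case: (cP m) => _ ->.
have /choice[eta etaP] n : exists eta, hopf_class q eta (x n).
  apply: hopf_class_lcs1 => //; apply: completion_lcs1 => //.
  exact: free_of_finite_rank_generated.
exists (fun n => to_coker _ (eta n)) => n.
have [pc _ zc] := cP n.
(* Since x_n = c_n x_(n+1)^(n+1), this combination is represented by 1 and so comes from H_2 of the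
   completion of [F]. *)
have : hopf_class q (eta n - eta n.+1 *+ n.+1 -
                     (zeta n - H2_map (@to_completion G) (xi n))) 1%g.
  have -> : (1 = x n / x n.+1 ^+ n.+1 / c n)%g.
    by rewrite /x telescope_limitE mulgK mulgV.
  have qxn : q (x n.+1 ^+ n.+1)%g = 1%g by rewrite gmorphX qx expg1n.
  apply: hopf_classB => //; last first.
    by apply: hopf_classB => //; exact: hopf_classMn.
  by rewrite gmulfM gmorphV qx qxn mulgV.
case/hopf_class1 => theta thetaE.
rewrite -zetaE -raddfMn -raddfD; apply/eqP; rewrite -subr_eq0 -raddfB.
(* The component [- xi n] undoes the modification of [zeta n] made in choosing [c n]. *)
apply/eqP/to_coker_eq0; exists (theta, - xi n).
rewrite /= /copair /= thetaE (raddfN (H2_map _)) opprB opprD.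
by rewrite -!addrA; congr (_ + (_ + _)); rewrite addrC subrK.
Qed.
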